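(* Let $f\colon[0,1]\to[0,1]$ be a continuous map. If $f$ is transitive, then there exist $n\in\mathbb{N}$ and an $f^n$-invariant closed set $X\subset[0,1]$ such that $f^n|_X$ is topologically conjugate to the full shift dynamical system $(\Sigma_2,\sigma)$.
   Context: $\mathbb{N}$ denotes the positive integers and $f^n$ the $n$-fold composition of $f$. The map $f$ is (topologically) transitive if for all nonempty open sets $U,V\subset[0,1]$ there is $n\in\mathbb{N}$ with $f^n(U)\cap V\neq\emptyset$. A set $X$ is $f^n$-invariant if $f^n(X)\subset X$. $(\Sigma_2,\sigma)$ is the one-sided full shift on two symbols: $\Sigma_2=\{0,1\}^{\mathbb{N}}$ with the product topology (discrete topology on $\{0,1\}$), and $\sigma(w_1w_2w_3\cdots)=w_2w_3\cdots$. Two continuous maps $S\colon X\to X$ and $T\colon Y\to Y$ of compact metric spaces are topologically conjugate if there is a homeomorphism $\phi\colon X\to Y$ with $\phi\circ S=T\circ\phi$. *)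

(* Defs.v *)
From HB Require Import structures.
From mathcomp Require Import all_boot all_order all_algebra.
From mathcomp Require Import all_classical all_reals all_analysis.
Import Order.TTheory GRing.Theory Num.Theory.
Import numFieldNormedType.Exports.

Set Implicit Arguments.
Unset Strict Implicit.
Unset Printing Implicit Defensive.

Local Open Scope classical_set_scope.
Local Open Scope ring_scope.

(* A set [A] of a topological space, used as a type, is [set_type A]: it carries
   the topology induced by the inclusion. In particular, the open sets of
   [unit_interval R] are the relatively open subsets of [0, 1]. *)
Definition unit_interval (R : realType) : set R := `[0, 1].

Arguments unit_interval R : clear implicits.

Definition topologically_transitive (T : topologicalType) (f : T -> T) : Prop :=
  forall U V : set T, open U -> open V -> U !=set0 -> V !=set0 ->
  exists n : nat, (0 < n)%N /\ (iter n f @` U) `&` V !=set0.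

Definition invariant_set (T : Type) (g : T -> T) (X : set T) : Prop :=
  g @` X `<=` X.

Definition restriction (T : Type) (g : T -> T) (X : set T)
    (gX : invariant_set g X) (x : X) : X :=
  exist _ (g (val x)) (mem_set (gX _ (imageP g (set_valP x)))).

Definition homeomorphism (X Y : topologicalType) (phi : X -> Y) : Prop :=
  continuous phi /\
  exists psi : Y -> X, [/\ continuous psi, cancel phi psi & cancel psi phi].

Definition topologically_conjugate (X Y : topologicalType)
    (S : X -> X) (T : Y -> Y) : Prop :=
  exists phi : X -> Y, homeomorphism phi /\ phi \o S = T \o phi.

(* The library's [cantor_space] is the product over [nat] of copies of the
   discrete space [bool]; the letter w_{i+1} of a word w is [w i]. *)
Definition full_shift (w : cantor_space) : cantor_space := fun i => w i.+1.

(* Main.v *)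
Require Import Defs.
From mathcomp Require Import all_boot all_order all_algebra.
From mathcomp Require Import all_classical all_reals all_analysis.
From mathcomp Require Import lra zify.
Import Order.TTheory GRing.Theory Num.Theory.
Import numFieldNormedType.Exports.

(** A transitive map [f] of [[0, 1]] has a horseshoe for some iterate
   [g = f^n]: two disjoint segments [I_0], [I_1], each of which [g] maps over
   both. Pulling segments back along a word [w] gives, for every word, a point
   of [I_(w 0)] whose [g]-orbit visits the segments in the order prescribed by
   [w]. In general a word can be shared by a whole segment of points, and a
   horseshoe only yields a factor map onto the shift. The point of the proof is
   to choose the horseshoe so that this cannot happen.

   The choice is dictated by a fixed point [c > 0] of [f]: [I_0] and [I_1] are
   taken strictly between 0 and [c], hence away from [c]. By transitivity every
   nonempty open set has a point whose orbit comes as close to [c] as desired;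
   since [c] is fixed, the orbit then lingers near [c], so that it is found
   there at a multiple of [n] as well ([orbit_visits_fixed]). Hence no
   nondegenerate segment can remain in the union of [I_0] and [I_1] under
   all iterates of [g], and the segments attached to longer and longer prefixes
   of a word shrink to a single point. This point depends continuously on the
   word, and the image of the Cantor space is the set [X]
   ([coding_map], [conjugate_image]).

   The horseshoe comes from the density of periodic points
   ([periodic_dense]). Take periodic points [y0 < y1 < y2 < y3] below [c], all
   fixed by [f^P]. The images of [[y0, y1]] under the iterates of [f^P]
   contain [[y0, y1]]. Some [f^k] sends a point of [[y0, y1]] below [y0], and
   [f^(P j + k)] still does for all [j]; by [orbit_visits_fixed], for some [j]
   it also sends a point of [[y0, y1]] above [y3]. So an iterate maps
   [[y0, y1]] over [[y0, y3]], and likewise for [[y2, y3]]; composing the two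
   gives one iterate that works for both ([horseshoe]).

   The real-variable part is carried out for a map of the whole real line with
   values in the unit interval, obtained by precomposing [f] with the
   retraction of the line onto [[0, 1]]. *)

Set Implicit Arguments.
Unset Strict Implicit.
Unset Printing Implicit Defensive.

Local Open Scope classical_set_scope.
Local Open Scope ring_scope.

(** * Iteration and intermediate values *)

Lemma continuous_iter (T : topologicalType) (f : T -> T) n :
  continuous f -> continuous (iter n f).
Proof.
move=> cf; elim: n => [|n IHn] x /=; first exact: cvg_id.
exact: (continuous_comp (IHn x) (cf _)).
Qed.

Lemma iter_fixed (T : Type) (f : T -> T) x k n :
  iter k f x = x -> iter (k * n) f x = x.
Proof.
by move=> fx; elim: n => [|n IHn]; rewrite ?muln0// mulnS iterD IHn.
Qed.

(** The points [u] and [v] may come in either order, which spares the later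
   arguments a distinction between increasing and decreasing crossings. *)
Lemma intermediate_value (R : realType) (g : R -> R) (a b u v y : R) :
  continuous g -> a <= u <= b -> a <= v <= b -> g u <= y <= g v ->
  exists2 t, a <= t <= b & g t = y.
Proof.
move=> cg /andP[au ub] /andP[av vb] /andP[uy yv].
have gy : Num.min (g u) (g v) <= y <= Num.max (g u) (g v).
  by rewrite ge_min uy le_max yv orbT.
have [uv|/ltW vu] := leP u v.
  have [t] := IVT uv (continuous_subspaceT cg) gy.
  rewrite in_itv/= => /andP[ut tv] gt; exists t => //.
  by rewrite (le_trans au ut) (le_trans tv vb).
rewrite minC maxC in gy.
have [t] := IVT vu (continuous_subspaceT cg) gy.
rewrite in_itv/= => /andP[vt tu] gt; exists t => //.
by rewrite (le_trans av vt) (le_trans tu ub).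
Qed.

(** The set of solutions is compact, so that it has a least element; an earlier
   crossing of the level would produce a smaller one. *)
Lemma first_hit (R : realType) (g : R -> R) (u v d : R) :
  continuous g -> u <= v -> g u <= d <= g v ->
  exists b, [/\ u <= b <= v, g b = d & forall t, u <= t <= b -> g t <= d].
Proof.
move=> cg uv gd; pose A := `[u, v] `&` g @^-1` [set d].
have uuv : u <= u <= v by rewrite lexx.
have vuv : u <= v <= v by rewrite lexx andbT.
have A0 : A !=set0.
  have [t tuv gt] := intermediate_value cg uuv vuv gd.
  by exists t; split=> //=; rewrite in_itv.
have cA : compact A.
  apply: compact_closedI; first exact: segment_compact.
  by apply: closed_comp => [t _|]; [exact: cg|exact: closed_eq].
have idA : {within A, continuous (@id R)}.
  by apply: continuous_subspaceT => t; exact: cvg_id.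
have [b bA bmin] := compact_EVT_min A0 cA idA.
move: bA; rewrite inE => -[/=]; rewrite in_itv/= => /andP[ub bv] gb.
exists b; split; [by rewrite ub|by []|move=> t /andP[ut tb]].
rewrite leNgt; apply/negP => dt.
have uut : u <= u <= t by rewrite lexx.
have tut : u <= t <= t by rewrite lexx andbT.
have ud : g u <= d <= g t by case/andP: gd => -> _; exact: ltW.
have [s /andP[us st] gs] := intermediate_value cg uut tut ud.
have /bmin bs : s \in A.
  rewrite inE; split=> //=.
  by rewrite in_itv/= us (le_trans st (le_trans tb bv)).
have ts : t = s by apply/eqP; rewrite eq_le st (le_trans tb bs).
by rewrite ts gs ltxx in dt.
Qed.

(** Reversal of time and of the sign of [g] in [first_hit]. *)
Lemma last_hit (R : realType) (g : R -> R) (u v c : R) :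
  continuous g -> u <= v -> g u <= c <= g v ->
  exists a, [/\ u <= a <= v, g a = c & forall t, a <= t <= v -> c <= g t].
Proof.
move=> cg uv /andP[uc cv]; pose h t := - g (- t).
have ch : continuous h.
  move=> t; apply: continuousN; apply: (@continuous_comp _ _ _ -%R g).
    exact: oppr_continuous.
  exact: cg.
have hc : h (- v) <= - c <= h (- u) by rewrite /h !opprK !lerN2 cv uc.
have [|b [/andP[vb bu] hb bmin]] := first_hit ch _ hc; first by rewrite lerN2.
exists (- b); split; first by rewrite lerNr bu lerNl vb.
  by apply: oppr_inj.
move=> t /andP[bt tv]; have := bmin (- t).
by rewrite /h opprK !lerN2; apply; rewrite tv lerNl bt.
Qed.

(** * Coding by nested segments *)

Definition in_segment (R : realType) (p : R * R) (x : R) : bool :=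
  p.1 <= x <= p.2.

(** Only inequalities are asked for: by the intermediate value theorem they give
   every value in [q], and they pass to subsegments of [q] at once. *)
Definition covers (R : realType) (g : R -> R) (p q : R * R) : Prop :=
  exists u v, [/\ in_segment p u, in_segment p v, g u <= q.1 & q.2 <= g v].

Lemma covers_segment (R : realType) (g : R -> R) (p q q' : R * R) :
  q.1 <= q'.1 -> q'.2 <= q.2 -> covers g p q -> covers g p q'.
Proof.
move=> q1 q2 [u [v [pu pv gu gv]]]; exists u, v; split=> //.
  exact: le_trans q1.
exact: le_trans gv.
Qed.

Lemma covers_nonempty (R : realType) (g : R -> R) (p q : R * R) :
  covers g p q -> p.1 <= p.2.
Proof. by case=> u [v [/andP[pu up] _ _ _]]; exact: le_trans up. Qed.

Lemma tighten_increasing (R : realType) (g : R -> R) (u v c d : R) :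
  continuous g -> u <= v -> c <= d -> g u <= c -> d <= g v ->
  exists a b, [/\ u <= a <= b, b <= v, g a = c, g b = d &
    forall t, a <= t <= b -> c <= g t <= d].
Proof.
move=> cg uv cd uc dv.
have [|b [/andP[ub bv] gb bmax]] := @first_hit R g u v d cg uv.
  by rewrite dv (le_trans uc cd).
have [|a [/andP[ua ab] ga amin]] := @last_hit R g u b c cg ub.
  by rewrite uc gb.
exists a, b; split=> //; first by rewrite ua.
move=> t /andP[a_t tb]; rewrite amin ?a_t//= bmax//.
by rewrite (le_trans ua a_t).
Qed.

(** Stop at the first passage through one end of [q] and start at the last passage
   through the other end before it: in between, [g] cannot leave [q]. *)
Lemma tighten (R : realType) (g : R -> R) (p q : R * R) :
  continuous g -> q.1 <= q.2 -> covers g p q ->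
  exists r, [/\ p.1 <= r.1, r.2 <= p.2, covers g r q &
    forall t, in_segment r t -> in_segment q (g t)].
Proof.
move=> cg q12 [u [v [/andP[pu up] /andP[pv vp] gu gv]]].
have [uv|/ltW vu] := leP u v.
  have [a [b [/andP[ua ab] bv ga gb H]]] := tighten_increasing cg uv q12 gu gv.
  exists (a, b); split=> //=; first exact: le_trans ua.
    exact: le_trans vp.
  by exists a, b; split; rewrite /in_segment/= ?lexx ?ab ?ga ?gb.
have cg' : continuous (\- g) by move=> t; apply: continuousN; exact: cg.
have [|||a [b [/andP[va ab] bu ga gb H]]] :=
    @tighten_increasing R (\- g) v u (- q.2) (- q.1) cg' vu.
  - by rewrite lerN2.
  - by rewrite /= lerN2.
  - by rewrite /= lerN2.
move: ga gb => /= /oppr_inj ga /oppr_inj gb.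
exists (a, b); split=> //=; first exact: le_trans va.
- exact: le_trans up.
- by exists b, a; split; rewrite /in_segment/= ?lexx ?ab ?ga ?gb.
- by move=> t /H /=; rewrite !lerN2 andbC.
Qed.

Lemma nested_segments (R : realType) (J : nat -> R * R) :
  (forall k, (J k).1 <= (J k).2) ->
  (forall k, (J k).1 <= (J k.+1).1 /\ (J k.+1).2 <= (J k).2) ->
  exists x, forall k, in_segment (J k) x.
Proof.
move=> J12 JS.
have J1le m n : (m <= n)%N -> (J m).1 <= (J n).1.
  move=> /subnK <-; elim: (n - m)%N => // k IH.
  exact: (le_trans IH (JS _).1).
have J2le m n : (m <= n)%N -> (J n).2 <= (J m).2.
  move=> /subnK <-; elim: (n - m)%N => // k IH.
  exact: (le_trans (JS _).2 IH).
pose A := range (fun k => (J k).1).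
have ubA k : ubound A (J k).2.
  move=> _ [m _ <-]; apply: (le_trans (J1le _ _ (leq_maxl m k))).
  exact: (le_trans (J12 _) (J2le _ _ (leq_maxr m k))).
exists (sup A) => k; apply/andP; split.
  apply: sup_upper_bound; last by exists k.
  by split; [exists (J 0%N).1, 0%N|exists (J 0%N).2].
by apply: ge_sup => //; exists (J 0%N).1, 0%N.
Qed.

Lemma nbhs_cylinder (w : cantor_space) (k : nat) :
  nbhs w [set w' : cantor_space | forall i, (i <= k)%N -> w' i = w i].
Proof.
have nb i : nbhs w [set w' : cantor_space | w' i = w i].
  by apply: (@proj_continuous nat (fun=> bool) i w [set w i]);
    rewrite nbhs_principalE.
elim: k => [|k IHk].
  by apply: filterS (nb 0%N) => w' w0 i; rewrite leqn0 => /eqP ->.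
apply: filterS (filterI IHk (nb k.+1)) => w' [H1 H2] i.
by rewrite leq_eqVlt => /predU1P[->//|/H1].
Qed.

Section coding.
Context (R : realType) (g : R -> R) (I : bool -> R * R).
Hypothesis g_cont : continuous g.
Hypothesis I_covers : forall i j, covers g (I i) (I j).
Hypothesis I_escape : forall i a b, a < b -> in_segment (I i) a ->
  in_segment (I i) b -> exists k x, a <= x <= b /\
    forall j, ~~ in_segment (I j) (iter k g x).

(** [J k w] is the segment attached to the prefix of length [k.+1] of [w].
   Cutting it down inside itself so as to map exactly onto [J k (full_shift w)] makes
   the segments both nested in [k] and equivariant under the shift; a choice
   made word by word would not be equivariant. *)
Lemma coding_segments : exists J : nat -> cantor_space -> R * R,
  [/\ forall w, J 0%N w = I (w 0%N),
      forall k w w', (forall i, (i <= k)%N -> w i = w' i) -> J k w = J k w',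
      forall k w, (J k w).1 <= (J k w).2,
      forall k w, (J k w).1 <= (J k.+1 w).1 /\ (J k.+1 w).2 <= (J k w).2 &
      forall k w x, in_segment (J k.+1 w) x ->
        in_segment (J k (full_shift w)) (g x)].
Proof.
have [cut cutP] : {cut : (R * R) * (R * R) -> R * R & forall pq,
    pq.2.1 <= pq.2.2 -> covers g pq.1 pq.2 ->
    [/\ pq.1.1 <= (cut pq).1, (cut pq).2 <= pq.1.2, covers g (cut pq) pq.2 &
      forall t, in_segment (cut pq) t -> in_segment pq.2 (g t)]}.
  apply: (@choice _ _ (fun pq r => pq.2.1 <= pq.2.2 -> covers g pq.1 pq.2 ->
    [/\ pq.1.1 <= r.1, r.2 <= pq.1.2, covers g r pq.2 &
      forall t, in_segment r t -> in_segment pq.2 (g t)])) => -[p q] /=.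
  have [[q12 pq]|npq] := pselect (q.1 <= q.2 /\ covers g p q).
    by have [r rP] := tighten g_cont q12 pq; exists r.
  by exists p => q12 pq; case: npq.
pose fix J k (w : cantor_space) {struct k} : R * R :=
  if k is m.+1 then cut (J m w, J m (full_shift w)) else I (w 0%N).
have I12 i : (I i).1 <= (I i).2 by exact: covers_nonempty (I_covers i true).
have JP k w : (J k w).1 <= (J k w).2 /\ covers g (J k w) (J k (full_shift w)).
  elim: k w => [|k IHk] w; first by split; [exact: I12|exact: I_covers].
  have [J12 Jc] := IHk w; have [sJ12 sJc] := IHk (full_shift w).
  have [_ _ cc _] := cutP (J k w, J k (full_shift w)) sJ12 Jc.
  have [s1 s2 _ _] := cutP (J k (full_shift w), J k (full_shift (full_shift w)))
    (IHk _).1 sJc.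
  by split; [exact: covers_nonempty cc|exact: covers_segment cc].
exists J; split => //.
- elim=> [w w' ww'|k IHk w w' ww'] /=; first by rewrite ww'.
  rewrite (IHk w w'); last by move=> i ik; apply: ww'; exact: leqW.
  rewrite (IHk (full_shift w) (full_shift w'))// => i ik.
  exact: ww'.
- by move=> k w; exact: (JP k w).1.
- move=> k w.
  by have [] := cutP (J k w, J k (full_shift w)) (JP _ _).1 (JP _ _).2.
- move=> k w x.
  have [_ _ _] := cutP (J k w, J k (full_shift w)) (JP _ _).1 (JP _ _).2.
  exact.
Qed.

(** A nondegenerate segment common to all the [J k w] would have all its images
   in the horseshoe, against [I_escape]. So [h w] is the only point of these
   segments, which forces both the equivariance and the continuity of [h]. *)
Lemma coding_map : exists h : cantor_space -> R,
  [/\ continuous h, forall w, in_segment (I (w 0%N)) (h w) &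
      forall w, g (h w) = h (full_shift w)].
Proof.
have [J [J0 Jcyl J12 JS gJ]] := coding_segments.
have itin w x i : (forall k, in_segment (J k w) x) ->
    forall k, in_segment (J k (iter i full_shift w)) (iter i g x).
  by move=> wx; elim: i => [|i IHi] k //=; apply: gJ.
have Juniq w x y : (forall k, in_segment (J k w) x) ->
    (forall k, in_segment (J k w) y) -> x = y.
  wlog xy : x y / x < y => [wl xJ yJ|xJ yJ].
    by case: (ltgtP x y) => // ?; [|symmetry]; exact: wl.
  have Iw0 z : in_segment (J 0%N w) z -> in_segment (I (w 0%N)) z by rewrite J0.
  have [k [z [/andP[xz zy] esc]]] :=
    I_escape xy (Iw0 _ (xJ 0%N)) (Iw0 _ (yJ 0%N)).
  have zJ j : in_segment (J j w) z.
    have /andP[Jx _] := xJ j; have /andP[_ yJ'] := yJ j.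
    by apply/andP; split; [exact: le_trans xz|exact: le_trans yJ'].
  have := itin w z k zJ 0%N; rewrite J0 => zI.
  by have := esc (iter k full_shift w 0%N); rewrite zI.
have [h hP] : {h : cantor_space -> R & forall w k, in_segment (J k w) (h w)}.
  apply: (@choice _ _ (fun w x => forall k, in_segment (J k w) x)) => w.
  by apply: nested_segments => k.
exists h; split.
- move=> w; apply/cvgrPdist_lt => e e0.
  (* The points at distance [e] on both sides of [h w] are left out by some
     segment of [w]; all points coded like [w] far enough lie between them. *)
  have out y : y != h w -> exists k, ~~ in_segment (J k w) y.
    move=> yw; apply: contrapT => nk; case/eqP: yw; apply: (Juniq w) => // k.
    by apply/negPn/negP => kn; apply: nk; exists k.
  have [|k1 o1] := out (h w - e); first by rewrite lt_eqF// gtrBl.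
  have [|k2 o2] := out (h w + e); first by rewrite gt_eqF// ltrDl.
  near=> w'.
  have ww' : forall i, (i <= maxn k1 k2)%N -> w' i = w i.
    by near: w'; exact: nbhs_cylinder.
  have h1 : in_segment (J k1 w) (h w').
    rewrite -(Jcyl k1 w' w)// => i ik; apply: ww'.
    by rewrite (leq_trans ik)// leq_maxl.
  have h2 : in_segment (J k2 w) (h w').
    rewrite -(Jcyl k2 w' w)// => i ik; apply: ww'.
    by rewrite (leq_trans ik)// leq_maxr.
  have g1 := hP w k1; have g2 := hP w k2.
  move: h1 h2 o1 o2 g1 g2; rewrite /in_segment !negb_and -!ltNge.
  move=> /andP[? ?] /andP[? ?] /orP o1 /orP o2 /andP[? ?] /andP[? ?].
  by rewrite ltr_norml; apply/andP; split; case: o1 o2 => ? [] ?; lra.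
- by move=> w; rewrite -J0; exact: hP.
- by move=> w; apply: (Juniq (full_shift w)) => [k|k]; [exact/gJ/hP|exact: hP].
Unshelve. all: by end_near. Qed.

End coding.

(** * Transitive maps: fixed and periodic points *)

Section transitive_real_map.
Context (R : realType) (F : R -> R).
Hypothesis F_cont : continuous F.
Hypothesis F_itv : forall x, 0 <= F x <= 1.
Hypothesis F_trans : forall a b c d : R, 0 <= a -> a < b -> b <= 1 ->
  0 <= c -> c < d -> d <= 1 ->
  exists n (x : R), [/\ (0 < n)%N, a < x < b & c < iter n F x < d].

(** If 0 were the only fixed point, the graph would be below the diagonal on
   [(0, 1]], and the left half of the interval would be invariant. *)
Lemma positive_fixed_point : exists2 c : R, 0 < c <= 1 & F c = c.
Proof.
have cFid : continuous (fun x => F x - x).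
  by move=> x; apply: cvgB; [exact: F_cont|exact: cvg_id].
apply: contrapT => nofix.
have fixP a : 0 <= a <= 1 -> a <= F a -> exists2 t, a <= t <= 1 & F t = t.
  move=> /andP[a0 a1] aF.
  have [|||t at1 /subr0_eq Ft] := @intermediate_value R _ a 1 1 a 0 cFid.
  - by rewrite a1 lexx.
  - by rewrite a1 lexx.
  - by rewrite subr_le0 subr_ge0 aF andbT; case/andP: (F_itv 1).
  by exists t.
have Flt x : 0 < x <= 1 -> F x < x.
  move=> /andP[x0 x1]; rewrite ltNge; apply/negP => xF.
  have [|t /andP[xt t1] Ft] := fixP _ _ xF; first by rewrite ltW.
  by apply: nofix; exists t; rewrite ?(lt_le_trans x0 xt).
have F0 : F 0 = 0.
  have F0ge : 0 <= F 0 by case/andP: (F_itv 0).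
  have [|t /andP[t0 t1] Ft] := fixP 0 _ F0ge; first by rewrite lexx ler01.
  have [t00|t0'] := eqVneq t 0; first by rewrite -t00 Ft.
  by case: nofix; exists t => //; rewrite lt_neqAle eq_sym t0' t0 t1.
have Fle x : 0 <= x <= 1 -> 0 <= F x <= x.
  move=> /andP[x0 x1]; have /andP[-> _] := F_itv x.
  have [->|xn0] := eqVneq x 0; first by rewrite F0 lexx.
  by rewrite ltW// Flt// lt_neqAle eq_sym xn0 x0 x1.
have [h0 h1] : 0 < (2^-1 : R) /\ (2^-1 : R) < 1 by split; lra.
have [||||||n [x [_ x12 Fn]]] := @F_trans 0 2^-1 2^-1 1; try lra.
have : 0 <= iter n F x <= x.
  elim: n {Fn} => [|n /andP[IH0 IHx]] /=; first lra.
  have /andP[-> /le_trans ->//] : 0 <= F (iter n F x) <= iter n F x.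
  by apply: Fle; lra.
lra.
Qed.

Lemma orbit_stays_near_fixed (c e : R) T : 0 < c -> F c = c -> e < c ->
  exists2 d, 0 <= d < c &
    forall x t, d < x <= c -> (t <= T)%N -> e < iter t F x.
Proof.
move=> c0 Fc ec; elim: T => [|T [d /andP[d0 dc] dP]].
  exists (Num.max 0 e); first by rewrite le_max lexx gt_max c0.
  by move=> x t /andP[]; rewrite gt_max leqn0 => /andP[_ ex] _ /eqP ->.
have iterc t : iter t F c = c by elim: t => //= t ->.
have : \forall x \near c, e < iter T.+1 F x.
  have cT : iter T.+1 F x @[x --> c] --> iter T.+1 F c.
    exact: (@continuous_iter R F T.+1 F_cont c).
  by apply: (cvgr_gt _ cT); rewrite iterc.
move=> /nbhs_ballP[r /= r0 rP].
exists (Num.max d (c - r)); first by rewrite le_max d0 gt_max dc/=; lra.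
move=> x t /andP[]; rewrite gt_max => /andP[dx rx] xc.
rewrite leq_eqVlt => /predU1P[->|]; last by apply: dP; rewrite dx.
by apply: rP; rewrite /ball/= ltr_norml; lra.
Qed.

(** An orbit that comes very close to a fixed point stays close for a long time,
   so that it can be caught there at a time in any prescribed residue class. *)
Lemma orbit_visits_fixed (c e a b : R) M i : 0 < c <= 1 -> F c = c -> e < c ->
  (0 < M)%N -> 0 <= a -> a < b -> b <= 1 ->
  exists j x, a < x < b /\ e < iter (M * j + i) F x.
Proof.
move=> /andP[c0 c1] Fc ec M0 a0 ab b1.
have [d /andP[d0 dc] dP] := orbit_stays_near_fixed (M + i) c0 Fc ec.
have [k [x [_ xab /andP[dk kc]]]] := F_trans a0 ab b1 d0 dc c1.
(* The least [M * j + i] with [j > k %/ M] exceeds [k] by at most [M + i]. *)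
exists (k %/ M).+1, x; split=> //.
have -> : (M * (k %/ M).+1 + i = (M - k %% M + i) + k)%N.
  rewrite mulnS; have := ltn_pmod k M0; have := divn_eq k M; rewrite mulnC; lia.
rewrite iterD; apply: dP; first by rewrite dk ltW.
by rewrite leq_add2r leq_subr.
Qed.

Lemma same_side (g : R -> R) (a b u v : R) : continuous g ->
  (forall t, a < t < b -> g t <> t) -> a < u < b -> a < v < b ->
  u < g u -> v < g v.
Proof.
move=> cg nofix uab vab ug; rewrite ltNge; apply/negP => gv.
have cgid : continuous (fun x => g x - x).
  by move=> x; apply: cvgB; [exact: cg|exact: cvg_id].
have [|||t tuv /subr0_eq gt] := @intermediate_value R _ (Num.min u v)
  (Num.max u v) v u 0 cgid.
- by rewrite ge_min le_max lexx !orbT.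
- by rewrite ge_min le_max lexx.
- by rewrite subr_le0 subr_ge0 gv ltW.
apply: (nofix t) => //; move: tuv; rewrite ge_min le_max.
by case/andP: uab vab => ? ? /andP[? ?] /andP[/orP[?|?] /orP[?|?]]; lra.
Qed.

(** If there is no periodic point in [(a, b)], every iterate moves all points of
   [(a, b)] in the same direction ([same_side]). A return of [x] to the right
   under [F^k] makes all [F^(k n)] move [x] to the right; a return of [y] to the
   left under [F^l] makes all [F^(l n)] move [y] to the left. These disagree
   for [F^(k l)]. *)
Lemma periodic_dense (a b : R) : 0 <= a -> a < b -> b <= 1 ->
  exists p y, [/\ (0 < p)%N, a < y < b & iter p F y = y].
Proof.
move=> a0 ab b1; apply: contrapT => noper.
have nofix n t : (0 < n)%N -> a < t < b -> iter n F t <> t.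
  by move=> n0 tab Fn; apply: noper; exists n, t.
pose m := (a + b) / 2; have am : a < m by rewrite /m; lra.
have mb : m < b by rewrite /m; lra.
have [||||||k [x [k0 xam Fx]]] := @F_trans a m m b; try lra.
have [||||||l [y [l0 ymb Fy]]] := @F_trans m b a m; try lra.
have xup n : x < iter (k * n.+1) F x.
  elim: n => [|n IHn]; first by rewrite muln1; lra.
  rewrite mulnS addnC iterD; apply: (@lt_trans _ _ (iter k F x)); first lra.
  apply: (@same_side _ a b x) IHn; rewrite ?muln_gt0 ?k0//; try lra.
    exact: continuous_iter.
  by move=> t; apply: nofix; rewrite muln_gt0 k0.
have ydown n : iter (l * n.+1) F y < y.
  elim: n => [|n IHn]; first by rewrite muln1; lra.
  rewrite mulnS addnC iterD; apply: (@le_lt_trans _ _ (iter l F y)); last lra.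
  rewrite leNgt; apply/negP => H.
  suff : y < iter (l * n.+1) F y by rewrite ltNge (ltW IHn).
  apply: (@same_side _ a b (iter l F y)) H; try lra.
    exact: continuous_iter.
  by move=> t; apply: nofix; rewrite muln_gt0 l0.
have := ydown k.-1; rewrite prednK// mulnC -{1}(prednK l0) => H.
suff : y < iter (k * l.-1.+1) F y by rewrite ltNge (ltW H).
apply: (@same_side _ a b x) (xup l.-1); try lra.
  exact: continuous_iter.
by move=> t; apply: nofix; rewrite muln_gt0 k0.
Qed.

(** * The horseshoe *)

Lemma periodic_segment_spreads (c u v y z : R) P :
  0 < c <= 1 -> F c = c -> 0 <= u -> u < v -> v <= 1 -> 0 < y -> y <= 1 ->
  z < c -> (0 < P)%N -> iter P F u = u -> iter P F v = v ->
  exists N, (0 < N)%N /\ covers (iter N F) (u, v) (y, z).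
Proof.
move=> c01 Fc u0 uv v1 y0 y1 zc P0 Pu Pv.
have [k [s [k0 /andP[us sv] /andP[_ sy]]]] := F_trans u0 uv v1 (lexx 0) y0 y1.
have [j [t [/andP[ut tv] zt]]] := orbit_visits_fixed k c01 Fc zc P0 u0 uv v1.
exists (P * j + k)%N; split; first by rewrite addn_gt0 k0 orbT.
(* As [u] and [v] are fixed by [F^P], [F^(P * j)] maps [[u, v]] over itself. *)
have [||||s' us'v s's] := @intermediate_value R (iter (P * j) F) u v u v s.
- exact: continuous_iter.
- by rewrite lexx ltW.
- by rewrite lexx ltW.
- by rewrite !iter_fixed// !ltW.
exists s', t; split; rewrite /in_segment/= ?(ltW ut) ?(ltW tv)//.
  by rewrite addnC iterD s's ltW.
by rewrite ltW.
Qed.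

Lemma covers_comp (g h : R -> R) (p q r : R * R) : continuous g ->
  covers g p q -> covers h q r -> covers (h \o g) p r.
Proof.
move=> cg [u [v [pu pv gu gv]]] [s [t [/andP[qs sq] /andP[qt tq] hs ht]]].
have [|s' ps' gs'] := intermediate_value cg pu pv (y := s).
  by rewrite (le_trans gu qs) (le_trans sq gv).
have [|t' pt' gt'] := intermediate_value cg pu pv (y := t).
  by rewrite (le_trans gu qt) (le_trans tq gv).
by exists s', t'; split; rewrite //= ?gs' ?gt'.
Qed.

(** The two segments spread at different times [N] and [N']; at time [N' + N] the
   first one passes through the second one, and conversely. *)
Lemma horseshoe (c : R) : 0 < c <= 1 -> F c = c ->
  exists n (y0 y1 y2 y3 : R),
   [/\ (0 < n)%N, 0 < y0 < y1, y1 < y2 < y3, y3 < c &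
     covers (iter n F) (y0, y1) (y0, y3) /\
     covers (iter n F) (y2, y3) (y0, y3)].
Proof.
move=> c01 Fc; have /andP[c0 c1] := c01.
have [|||p0 [y0 [p00 y0P py0]]] := @periodic_dense 0 (c / 4); try lra.
have [|||p1 [y1 [p10 y1P py1]]] := @periodic_dense (c / 4) (c / 2); try lra.
have [|||p2 [y2 [p20 y2P py2]]] := @periodic_dense (c / 2) (3 * c / 4); try lra.
have [|||p3 [y3 [p30 y3P py3]]] := @periodic_dense (3 * c / 4) c; try lra.
pose P := (p0 * p1 * p2 * p3)%N.
have P0 : (0 < P)%N by rewrite !muln_gt0 p00 p10 p20 p30.
have Py0 : iter P F y0 = y0 by rewrite /P -!mulnA iter_fixed.
have Py1 : iter P F y1 = y1 by rewrite /P (mulnC p0) -!mulnA iter_fixed.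
have Py2 : iter P F y2 = y2 by rewrite /P (mulnC _ p2) -!mulnA iter_fixed.
have Py3 : iter P F y3 = y3 by rewrite /P mulnC iter_fixed.
have [||||||N [N0 NP]] :=
  @periodic_segment_spreads c y0 y1 y0 y3 P c01 Fc _ _ _ _ _ _ P0 Py0 Py1;
  try lra.
have [||||||N' [N'0 N'P]] :=
  @periodic_segment_spreads c y2 y3 y0 y3 P c01 Fc _ _ _ _ _ _ P0 Py2 Py3;
  try lra.
exists (N' + N)%N, y0, y1, y2, y3; split; try lra.
  by rewrite addn_gt0 N0 orbT.
have E a b : iter (a + b) F = iter a F \o iter b F.
  by apply/funext => x; rewrite iterD.
split.
- rewrite E; apply: (covers_comp _ (q := (y2, y3))) N'P.
    exact: continuous_iter.
  by apply: covers_segment NP => /=; lra.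
- rewrite addnC E; apply: (covers_comp _ (q := (y0, y1))) NP.
    exact: continuous_iter.
  by apply: covers_segment N'P => /=; lra.
Qed.

(** Points above [y3] lie outside the horseshoe, and the orbits of any segment
   under [F^n] get there because they approach [c > y3]. *)
Lemma embedded_shift : exists n (h : cantor_space -> R),
  [/\ (0 < n)%N, continuous h, injective h, forall w, 0 <= h w <= 1 &
      forall w, iter n F (h w) = h (full_shift w)].
Proof.
have [c c01 Fc] := positive_fixed_point.
have [n [y0 [y1 [y2 [y3 [n0 y01 y123 y3c [cov0 cov1]]]]]]] := horseshoe c01 Fc.
have /andP[c0 c1] := c01.
pose I i := if i then (y2, y3) else (y0, y1).
have cF : continuous (iter n F) by exact: continuous_iter.
have Icov i j : covers (iter n F) (I i) (I j).
  have covI : covers (iter n F) (I i) (y0, y3) by case: i.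
  by apply: covers_segment covI; case: j => /=; lra.
have Ibd i x : in_segment (I i) x -> y0 <= x <= y3.
  by rewrite /in_segment; case: i => /=; lra.
have esc i a b : a < b -> in_segment (I i) a -> in_segment (I i) b ->
    exists k x, a <= x <= b /\
      forall j, ~~ in_segment (I j) (iter k (iter n F) x).
  move=> ab /Ibd a03 /Ibd b03.
  have [|||j [x [/andP[ax xb] jx]]] :=
    orbit_visits_fixed 0 (a := a) (b := b) c01 Fc y3c n0; try lra.
  exists j, x; split; first by rewrite !ltW.
  move=> i'; apply/negP; rewrite -iterM mulnC => /Ibd.
  by rewrite addn0 in jx; lra.
have [h [ch hI hS]] := coding_map cF Icov esc.
exists n, h; split=> //.
- move=> w w' ww'; apply/funext => i.
  have hi k v : h (iter k full_shift v) = iter k (iter n F) (h v).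
    by elim: k => //= k IHk; rewrite -hS IHk.
  have nth k v : iter k full_shift v 0%N = v k.
    by elim: k v => // k IHk v; rewrite iterSr IHk.
  have := hI (iter i full_shift w); have := hI (iter i full_shift w').
  rewrite !hi ww' !nth /in_segment; case: (w i) (w' i) => -[] //=; lra.
- by move=> w; have /Ibd := hI w; lra.
Qed.

End transitive_real_map.

(** * Conjugacy onto the image of an equivariant embedding *)

Lemma continuous_to_subtype (S T : topologicalType) (A : set T) (h : S -> A) :
  continuous (fun s => val (h s) : T) -> continuous h.
Proof.
move=> /continuousP ch; apply/continuousP => _ [V oV <-].
exact: ch.
Qed.

Lemma continuous_subtype_val (T : topologicalType) (A : set T) :
  continuous (fun x : A => val x : T).
Proof. exact: (@initial_continuous A T set_val). Qed.

Lemma hausdorff_subtype (T : topologicalType) (A : set T) :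
  hausdorff_space T -> hausdorff_space A.
Proof.
move=> hT p q pq; apply: val_inj; apply: hT => U V pU qV.
have cval := @continuous_subtype_val T A.
by have [z [zU zV]] := pq _ _ (cval p _ pU) (cval q _ qV); exists (val z).
Qed.

(** A continuous injection of a compact space into a Hausdorff space maps closed
   sets to closed sets, so that its inverse is continuous on its image. *)
Lemma conjugate_image (K T : topologicalType) (S : K -> K) (g : T -> T)
    (h : K -> T) :
  compact [set: K] -> hausdorff_space T -> continuous h -> injective h ->
  (forall w, g (h w) = h (S w)) ->
  exists gX : invariant_set g (range h),
    closed (range h) /\ topologically_conjugate (restriction gX) S.
Proof.
move=> cK hT ch hI hS.
have closed_image C : closed C -> closed (h @` C).
  move=> cC; apply: compact_closed => //; apply: continuous_compact.
    exact: continuous_subspaceT.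
  exact: (subclosed_compact cC cK).
have gX : invariant_set g (range h).
  by move=> _ [_ [w _ <-] <-]; exists (S w); rewrite ?hS.
exists gX; split; first exact: closed_image closedT.
have [phi phiP] : {phi : range h -> K & forall x, h (phi x) = val x}.
  apply: (@choice _ _ (fun (x : range h) w => h w = val x)) => -[x /= /set_mem].
  by case=> w _ <-; exists w.
pose psi (w : K) : range h := exist _ (h w) (mem_set (imageT h w)).
have psiK : cancel psi phi by move=> w; apply: hI; rewrite phiP.
have phiK : cancel phi psi by move=> x; apply: val_inj; rewrite /= phiP.
exists phi; split; last first.
  by apply/funext => x /=; apply: hI; rewrite phiP -hS phiP.
split; last first.
  by exists psi; split=> //; exact: continuous_to_subtype.
apply/continuous_closedP => C cC.
have -> : phi @^-1` C = (fun x : range h => val x : T) @^-1` (h @` C).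
  apply/seteqP; split=> x /=; first by exists (phi x).
  by case=> w Cw; rewrite -phiP => /hI <-.
have /continuous_closedP := @continuous_subtype_val T (range h).
by apply; exact: closed_image.
Qed.

(** * Extension to the real line *)

Lemma clamp_subproof (R : realType) (x : R) :
  Num.max 0 (Num.min 1 x) \in unit_interval R.
Proof.
by rewrite inE /unit_interval/= in_itv/= le_max lexx ge_max ler01 ge_min lexx.
Qed.

Definition clamp (R : realType) (x : R) : unit_interval R :=
  exist (fun y => y \in unit_interval R) _ (clamp_subproof x).

Lemma unit_interval_val (R : realType) (y : unit_interval R) :
  0 <= (val y : R) <= 1.
Proof. by have := set_valP y; rewrite /unit_interval/= in_itv. Qed.

Lemma clamp_id (R : realType) (x : R) : 0 <= x <= 1 -> val (clamp x) = x.
Proof. by move=> /andP[x0 x1]; rewrite /= (min_idPr x1) (max_idPr x0). Qed.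

Lemma valK_clamp (R : realType) : cancel val (@clamp R).
Proof.
by move=> y; apply: val_inj; rewrite clamp_id//; exact: unit_interval_val.
Qed.

Lemma continuous_clamp (R : realType) : continuous (@clamp R).
Proof.
apply: continuous_to_subtype => x.
apply: (@continuous_max R R (fun=> 0) (fun x => Num.min 1 x)).
  exact: cvg_cst.
apply: (@continuous_min R R (fun=> 1) id); [exact: cvg_cst|exact: cvg_id].
Qed.

Section real_extension.
Context (R : realType) (f : unit_interval R -> unit_interval R).

Definition real_extension (x : R) : R := val (f (clamp x)).

Lemma real_extension_itv x : 0 <= real_extension x <= 1.
Proof. exact: unit_interval_val. Qed.

Lemma iter_real_extension n y :
  iter n real_extension (val y) = val (iter n f y).
Proof. by elim: n => //= n ->; rewrite /real_extension valK_clamp. Qed.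

Lemma continuous_real_extension : continuous f -> continuous real_extension.
Proof.
move=> cf x.
apply: (@continuous_comp _ _ _ (@clamp R) (fun y => val (f y))).
  exact: continuous_clamp.
apply: (@continuous_comp _ _ _ f (fun y : unit_interval R => val y : R)).
  exact: cf.
exact: continuous_subtype_val.
Qed.

Lemma real_extension_transitive : topologically_transitive f ->
  forall a b c d : R, 0 <= a -> a < b -> b <= 1 -> 0 <= c -> c < d -> d <= 1 ->
  exists n x, [/\ (0 < n)%N, a < x < b & c < iter n real_extension x < d].
Proof.
move=> tf a b c d a0 ab b1 c0 cd d1.
pose U (p q : R) := (fun y : unit_interval R => val y : R) @^-1` `]p, q[.
have oU p q : open (U p q).
  have /continuousP := @continuous_subtype_val R (unit_interval R).
  by apply; exact: interval_open.
have U0 p q : 0 <= p -> p < q -> q <= 1 -> U p q !=set0.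
  move=> p0 pq q1; exists (clamp ((p + q) / 2)).
  by rewrite /U/preimage/mkset clamp_id ?in_itv/=; lra.
have [n [n0 [_ [[y Uy <-] Vy]]]] :=
  tf _ _ (oU a b) (oU c d) (U0 _ _ a0 ab b1) (U0 _ _ c0 cd d1).
move: Uy Vy; rewrite /U/preimage/mkset !in_itv/= => Uy Vy.
by exists n, (val y); rewrite iter_real_extension.
Qed.

End real_extension.

(** * The embedded full shift *)

Theorem theorem1p5 (R : realType) (f : unit_interval R -> unit_interval R)
    (f_cont : continuous f) (f_trans : topologically_transitive f) :
  exists (n : nat) (X : set (unit_interval R))
         (fnX : invariant_set (iter n f) X),
    [/\ (0 < n)%N, closed X &
        topologically_conjugate (restriction fnX) full_shift].
Proof.
have [n [h [n0 ch hI h01 hS]]] := embedded_shift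
  (continuous_real_extension f_cont) (real_extension_itv f)
  (real_extension_transitive f_trans).
pose H w := clamp (h w).
have cH : continuous H.
  by move=> w; apply: continuous_comp (ch w) _; exact: continuous_clamp.
have HI : injective H.
  by move=> w w' /(congr1 val); rewrite !clamp_id//; exact: hI.
have HS w : iter n f (H w) = H (full_shift w).
  by apply: val_inj; rewrite -iter_real_extension !clamp_id// hS.
have hausd : hausdorff_space (unit_interval R).
  exact/hausdorff_subtype/Rhausdorff.
have [fnX [clX conj]] := conjugate_image cantor_space_compact hausd cH HI HS.
by exists n, (range H), fnX.
Qed.
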